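(* In the setting and with the notation of the context (birth--death process with killing, $c_i\not\equiv0$), let $\lambda_0=\inf\{D(f):f\in\mathscr K,\ \|f\|=1\}$. For each $f\in\mathscr F$ define $$\xi=\xi_f=\begin{cases}\displaystyle\inf_{E\ni i\ge2}\frac{f_1-f_i+II_i^{\tilde c}(f)}{II_i(f)},&N=\infty,\\[2ex]\displaystyle\Big(\inf_{E\ni i\ge2}\frac{f_1-f_i+II_i^{\tilde c}(f)}{II_i(f)}\Big)\wedge\frac{\sum_{j=1}^N\tilde c_j\mu_jf_j}{\sum_{j=1}^N\mu_jf_j},&N<\infty,\end{cases}$$ and, for $\eta\in[0,\xi]$, $$\zeta(\eta,f)=\begin{cases}\displaystyle\inf_{E\ni i\ge2,\ \tilde c_i<\eta}\Big[\tilde c_i+\frac{(\eta-\tilde c_i)f_i}{f_1+II_i^{\tilde c-\eta}(f)}\Big],&\{E\ni i\ge2:\tilde c_i<\eta\}\ne\emptyset,\\ \eta,&\{E\ni i\ge2:\tilde c_i<\eta\}=\emptyset.\end{cases}$$ Then $$\lambda_0\ge\inf_{i\in E}c_i+\zeta(\eta,f)\quad\text{and}\quad\eta\ge\zeta(\eta,f),\qquad f\in\mathscr F,\ \eta\in[0,\xi_f].$$ Moreover, for fixed $f$, $\zeta(\eta,f)$ is increasing in $\eta$, and furthermore $$\lambda_0=\inf_{i\in E}c_i+\sup_{f\in\mathscr F}\zeta(\xi_f,f).$$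
   Context: Setting. $E=\{i\in\mathbb Z:1\le i<N+1\}$, $1\le N\le\infty$; birth rates $b_i>0$ for $1\le i<N$, $b_N=0$ if $N<\infty$; death rates $a_i>0$ for $2\le i<N+1$, $a_1=0$; killing rates $c_i\ge0$ for $i\in E$, not all zero. $\mu_1=1$, $\mu_k=\frac{b_1\cdots b_{k-1}}{a_2\cdots a_k}$ for $2\le k<N+1$; $\|\cdot\|$ is the norm of $L^2(\mu)$; $\mathscr K$ is the set of finitely supported functions on $E$; $D(f)=\sum_{1\le i<N}\mu_ib_i(f_{i+1}-f_i)^2+\sum_{i\in E}\mu_ic_if_i^2$. For a sequence $r=(r_i)$ and a positive function $f$ on $E$: $II_1^r(f)=0$ and $II_i^r(f)=\sum_{k=1}^{i-1}\frac1{\mu_kb_k}\sum_{j=1}^kr_j\mu_jf_j$ for $E\ni i\ge2$; $II(f)$ denotes $II^r(f)$ with $r\equiv1$; $\tilde c-\eta$ denotes the sequence $(\tilde c_i-\eta)_i$. $\tilde c_i=c_i-\inf_{j\in E}c_j$. $$\mathscr F=\{f>0\text{ on }E:\ f_i<f_1+II_i^{\tilde c}(f)\text{ for all }E\ni i\ge2\}.$$ ''Increasing'' is in the weak sense; the infimum over an empty set is $\infty$. *)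

(* Defs.v *)
From mathcomp Require Import all_boot all_order all_algebra.
From mathcomp Require Import all_classical all_reals all_analysis.

Set Implicit Arguments.
Unset Strict Implicit.
Unset Printing Implicit Defensive.

Import Order.TTheory GRing.Theory Num.Theory.

Local Open Scope classical_set_scope.
Local Open Scope ring_scope.

(* [N : option nat] encodes 1 <= N <= oo, with [None] for N = oo.  Functions
   on E are total functions on [nat] whose values outside E are never used. *)
Definition ltN (N : option nat) (i : nat) : bool :=
  if N is Some n then (i < n)%N else true.

Definition leN (N : option nat) (i : nat) : bool :=
  if N is Some n then (i <= n)%N else true.

Definition E (N : option nat) : set nat :=
  [set i | (1 <= i)%N /\ leN N i].

(* i in E with i >= 2 *)
Definition E2 (N : option nat) : set nat :=
  [set i | (2 <= i)%N /\ leN N i].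

Section BirthDeathKilling.
Context {R : realType}.
Implicit Types (N : option nat) (a b c r f : nat -> R) (eta : R) (i k : nat).

Definition bd_killing_rates N a b c : Prop :=
  [/\ if N is Some n then (1 <= n)%N /\ b n = 0 else True,
      forall i, (1 <= i)%N -> ltN N i -> 0 < b i,
      a 1%N = 0 /\ (forall i, (2 <= i)%N -> leN N i -> 0 < a i),
      forall i, E N i -> 0 <= c i &
      exists2 i, E N i & c i != 0].

Definition mu a b k : R :=
  (\prod_(1 <= j < k) b j) / (\prod_(2 <= j < k.+1) a j).

Definition finsupp_fun N f : Prop := finite_set [set i | E N i /\ f i != 0].

Definition L2norm N a b f : \bar R :=
  ((\sum_(1 <= i <oo | leN N i) (mu a b i * f i ^+ 2)%:E) `^ 2^-1)%E.

Definition Dform N a b c f : \bar R :=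
  (\sum_(1 <= i <oo | ltN N i) (mu a b i * b i * (f i.+1 - f i) ^+ 2)%:E
   + \sum_(1 <= i <oo | leN N i) (mu a b i * c i * f i ^+ 2)%:E)%E.

Definition lambda0 N a b c : \bar R :=
  ereal_inf [set Dform N a b c f | f in
    [set f | finsupp_fun N f /\ L2norm N a b f = 1%E]].

Definition infc N c : R := inf [set c i | i in E N].

Definition ctilde N c i : R := c i - infc N c.

Definition II a b r f i : R :=
  \sum_(1 <= k < i) (mu a b k * b k)^-1 *
    \sum_(1 <= j < k.+1) r j * mu a b j * f j.

Definition classF N a b c : set (nat -> R) :=
  [set f | (forall i, E N i -> 0 < f i) /\
           (forall i, E2 N i -> f i < f 1%N + II a b (ctilde N c) f i)].

Definition xi N a b c f : \bar R :=
  let I := ereal_inf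
    [set ((f 1%N - f i + II a b (ctilde N c) f i) / II a b (fun=> 1) f i)%:E
      | i in E2 N] in
  if N is Some n then
    Order.min I
      ((\sum_(1 <= j < n.+1) ctilde N c j * mu a b j * f j) /
       (\sum_(1 <= j < n.+1) mu a b j * f j))%:E
  else I.

Definition zeta N a b c eta f : \bar R :=
  let S := [set i | E2 N i /\ ctilde N c i < eta] in
  if `[< S !=set0 >] then
    ereal_inf
      [set (ctilde N c i + (eta - ctilde N c i) * f i /
             (f 1%N + II a b (fun j => ctilde N c j - eta) f i))%:E | i in S]
  else eta%:E.

Lemma mu_gt0 N a b c k : bd_killing_rates N a b c -> E N k -> 0 < mu a b k.
Proof.
move=> [_ bP [_ aP] _ _] [k1 kN]; rewrite /mu divr_gt0 //.
- rewrite big_nat; apply: prodr_gt0 => j /andP[j1 jk]; apply: bP => //.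
  by case: N kN {aP} => //= n; apply: leq_trans.
- rewrite big_nat; apply: prodr_gt0 => j /andP[j1 jk]; apply: aP => //.
  by case: N kN {bP} => //= n; apply: leq_trans.
Qed.

Lemma ctilde_ge0 N a b c i :
  bd_killing_rates N a b c -> E N i -> 0 <= ctilde N c i.
Proof.
move=> [_ _ _ cP _] Ei; rewrite subr_ge0; apply: ge_inf; last by exists i.
by exists 0 => _ [j Ej <-]; exact: cP.
Qed.

(* On the class F the infimum [xi] is a nonnegative real, so that taking its
   real value with [fine] is harmless. *)
Lemma xi_fin_num N a b c f :
  bd_killing_rates N a b c -> classF N a b c f ->
  (0 <= xi N a b c f)%E /\ xi N a b c f \is a fin_num.
Proof.
move=> H [f0 fF].
have leE j k : (1 <= j <= k)%N -> leN N k -> E N j.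
  move=> /andP[j1 jk] kN; split => //.
  by case: N kN {H f0 fF} => //= n; apply: leq_trans.
have II0 i : E2 N i -> 0 <= II a b (fun=> 1) f i.
  move=> [i2 iN]; rewrite /II big_nat; apply: sumr_ge0 => k /andP[k1 ki].
  have Ek : E N k by apply: (leE k i) => //; rewrite k1 ltnW.
  apply: mulr_ge0.
    rewrite invr_ge0 mulr_ge0 //; first exact/ltW/(mu_gt0 H).
    case: H => _ bP _ _ _; apply/ltW/bP => //.
    by case: N iN {f0 fF leE Ek bP} => //= n; apply: leq_trans.
  rewrite big_nat; apply: sumr_ge0 => j /andP[j1 jk].
  have Ej : E N j by apply: (leE j k); [rewrite j1|case: Ek].
  by rewrite mul1r mulr_ge0 //; apply/ltW; [exact: (mu_gt0 H)|exact: f0].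
have t0 i : E2 N i ->
    0 <= (f 1%N - f i + II a b (ctilde N c) f i) / II a b (fun=> 1) f i.
  move=> Ei; rewrite divr_ge0 ?II0 //.
  by rewrite addrAC subr_ge0; exact/ltW/fF.
set I := ereal_inf
    [set ((f 1%N - f i + II a b (ctilde N c) f i) / II a b (fun=> 1) f i)%:E
      | i in E2 N].
have I0 : (0 <= I)%E.
  by apply/ereal_infP => _ [i Ei <-]; rewrite lee_fin t0.
have xi0 : (0 <= xi N a b c f)%E.
  rewrite /xi -/I; case: N @I H f0 leE fF II0 t0 I0 => [n|] I H f0 leE _ _ _ //.
  rewrite le_min => -> /=; rewrite lee_fin divr_ge0 // big_nat.
    apply: sumr_ge0 => j /andP[j1 jn].
    have Ej : E (Some n) j by split.
    apply: mulr_ge0; last exact/ltW/f0.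
    by apply: mulr_ge0; [exact: (ctilde_ge0 H)|exact/ltW/(mu_gt0 H)].
  apply: sumr_ge0 => j /andP[j1 jn]; have Ej : E (Some n) j by split.
  by rewrite mulr_ge0 //; apply/ltW; [exact: (mu_gt0 H)|exact: f0].
split => //; rewrite ge0_fin_numE // /xi -/I {xi0}.
case: N @I {H f0 leE II0 I0 fF} t0 => [n|] I t0.
  by rewrite gt_min ltry orbT.
apply: le_lt_trans (ltry _); apply: ereal_inf_lbound; exists 2%N => //.
Qed.

End BirthDeathKilling.

(* Main.v *)
(* Write t = ctilde, so that D_c = D_t + (inf c) |.|^2.  For f in F and
   eta <= xi_f, the function g = f_1 + II^{t - eta}(f) satisfies g >= f > 0 and
   -(Omega g)_i >= t_i g_i + (eta - t_i) f_i, so Barta's inequality bounds the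
   bottom of the spectrum of D_t by inf_i [t_i + (eta - t_i) f_i / g_i].  This
   is zeta(eta, f), since the sites with t_i >= eta and the site 1 contribute
   values >= eta.
   For the equality, let l > 0 lie below the bottom of the spectrum of D_t and
   let f solve f = f_1 + II^{t - l}(f), f_1 = 1.  Testing D_t on the truncations
   of f shows that f is positive with nonnegative outgoing flux at N; hence
   f is in F, l <= xi_f and zeta(l, f) = l, and monotonicity of zeta in eta
   gives zeta(xi_f, f) >= l. *)
Require Import Defs.
From mathcomp Require Import all_boot all_order all_algebra.
From mathcomp Require Import all_classical all_reals all_analysis.
From mathcomp Require Import ring lra.

Set Implicit Arguments.
Unset Strict Implicit.
Unset Printing Implicit Defensive.

Import Order.TTheory GRing.Theory Num.Theory.

Local Open Scope classical_set_scope.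
Local Open Scope ring_scope.

(** * Initial segments of the index set *)

Lemma E_le N j k : (1 <= j <= k)%N -> E N k -> E N j.
Proof.
move=> /andP[j1 jk] [_ kN]; split=> //.
by case: N kN => //= n; apply: leq_trans.
Qed.

Lemma E_ltN N m i : E N m -> (i < m)%N -> ltN N i.
Proof. by case: N => //= n [_ mn] im; apply: leq_trans im mn. Qed.

(** * Reduction of [lambda0] to finite truncations *)

Section Truncation.
Context {R : realType}.
Implicit Types (N : option nat) (a b c f h : nat -> R) (m : nat) (L : R).

Lemma eseries_truncate (u : nat -> \bar R) (P : pred nat) m n :
  (m <= n)%N -> (forall i, (n <= i)%N -> P i -> u i = 0%E) ->
  (\sum_(m <= i <oo | P i) u i = \sum_(m <= i < n | P i) u i)%E.
Proof.
move=> mn u0; apply: lim_near_cst => //.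
near=> k; have nk : (n <= k)%N by near: k; exact: nbhs_infty_ge.
rewrite (big_cat_nat (n := n)) //= [X in (_ + X)%E]big_nat_cond.
rewrite [X in (_ + X)%E]big1 ?adde0 //.
by move=> i /andP[/andP[ni _] Pi]; exact: u0.
Unshelve. all: by end_near. Qed.

(** Squared norm of [h] cut off beyond [m]; values past [m] are never read, so [h] may be any
    sequence. *)
Definition mass a b m h : R := \sum_(1 <= i < m.+1) mu a b i * h i ^+ 2.

(* The form [Dform] on functions vanishing beyond [m]; the boundary edge
   [(m, m+1)] contributes [mu_m b_m h_m^2], which is [0] for [m = N] as
   [b_N = 0]. *)
Definition energy a b c m h : R :=
  \sum_(1 <= i < m) mu a b i * b i * (h i.+1 - h i) ^+ 2 +
  mu a b m * b m * h m ^+ 2 + \sum_(1 <= i < m.+1) mu a b i * c i * h i ^+ 2.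

Lemma birth_rate_ge0 N a b c i : bd_killing_rates N a b c -> E N i -> 0 <= b i.
Proof.
move=> [bN b0 _ _ _] [i1 iN].
case iN': (ltN N i); first exact/ltW/b0.
case: N bN iN iN' {b0} => //= n [_ bn] iN.
by rewrite ltn_neqAle iN andbT => /negbFE/eqP->; rewrite bn.
Qed.

Lemma mass_ge0 N a b c m h :
  bd_killing_rates N a b c -> E N m -> 0 <= mass a b m h.
Proof.
move=> H Em; rewrite /mass big_nat; apply: sumr_ge0 => i im.
by rewrite mulr_ge0 ?sqr_ge0//; exact/ltW/(mu_gt0 H)/(E_le im).
Qed.

Lemma energy_ge0 N a b c m h :
  bd_killing_rates N a b c -> E N m -> 0 <= energy a b c m h.
Proof.
move=> H Em; have mb i : (1 <= i <= m)%N -> 0 <= mu a b i * b i.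
  move=> im; have Ei := E_le im Em.
  by rewrite mulr_ge0 ?(birth_rate_ge0 H)//; exact/ltW/(mu_gt0 H).
apply: addr_ge0; first apply: addr_ge0.
- rewrite big_nat; apply: sumr_ge0 => i /andP[i1 im].
  by rewrite mulr_ge0 ?sqr_ge0 ?mb// i1 ltnW.
- by rewrite mulr_ge0 ?sqr_ge0 ?mb// leqnn andbT; case: Em.
rewrite big_nat; apply: sumr_ge0 => i im; have Ei := E_le im Em.
apply: mulr_ge0 (sqr_ge0 _); apply: mulr_ge0; first exact/ltW/(mu_gt0 H).
by case: H => _ _ _ c0 _; exact: c0.
Qed.

Lemma Dform_energy N a b c m f : bd_killing_rates N a b c -> E N m ->
  (forall i, E N i -> (m < i)%N -> f i = 0) ->
  Dform N a b c f = (energy a b c m f)%:E.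
Proof.
move=> [bN _ _ _ _] Em f0; have [m1 mN] := Em.
rewrite /Dform (@eseries_truncate _ _ _ m.+1)//; last first.
  move=> i mi iN; have Ei1 : E N i.+1 by [].
  have Ei : E N i by apply: E_le Ei1; rewrite leqnSn (leq_trans _ mi).
  by rewrite (f0 _ Ei) ?(f0 _ Ei1) ?subrr ?expr0n ?mulr0// leqW.
rewrite (@eseries_truncate _ _ _ m.+1)//; last first.
  move=> i mi iN; rewrite f0 ?expr0n ?mulr0//; split => //.
  exact: leq_trans mi.
rewrite /energy !EFinD; congr (_ + _)%E; last first.
  rewrite big_mkcond -sumEFin; apply: eq_big_nat => i im.
  by case: (E_le im Em) => _ ->.
rewrite big_mkcond big_nat_recr//=; congr (_ + _)%E.
  rewrite -sumEFin; apply: eq_big_nat => i /andP[i1 im].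
  by rewrite (E_ltN Em im).
case mN': (ltN N m).
  by rewrite f0 ?sub0r ?sqrrN//; split => //; case: N mN' {bN Em mN f0}.
case: N bN mN mN' {Em f0} => //= n [_ bn] mn.
by rewrite ltn_neqAle mn andbT => /negbFE/eqP->; rewrite bn mulr0 mul0r.
Qed.

Lemma L2norm_mass N a b c m f : bd_killing_rates N a b c -> E N m ->
  (forall i, E N i -> (m < i)%N -> f i = 0) ->
  L2norm N a b f = (Num.sqrt (mass a b m f))%:E.
Proof.
move=> H Em f0; have [m1 mN] := Em.
rewrite /L2norm (@eseries_truncate _ _ _ m.+1)//; last first.
  move=> i mi iN; rewrite f0 ?expr0n ?mulr0//; split => //.
  exact: leq_trans mi.
rewrite -powR12_sqrt ?(mass_ge0 _ H)// -poweR_EFin; congr (_ `^ _)%E.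
rewrite big_mkcond -sumEFin; apply: eq_big_nat => i im.
by case: (E_le im Em) => _ ->.
Qed.

(** For finite [N] the bound is [N]; otherwise the largest support site plus one, which lies in [E]
    even when the support is empty. *)
Lemma finsupp_bounded N a b c f : bd_killing_rates N a b c ->
  finsupp_fun N f ->
  exists2 m, E N m & forall i, E N i -> (m < i)%N -> f i = 0.
Proof.
case: N => [n|] => [[[n1 _] _ _ _ _] _|_ /finite_seqP[s sE]].
  exists n; first by split => /=.
  by move=> i [_ /= iN]; rewrite ltnNge iN.
exists (\max_(i <- s) i).+1; first by split.
move=> i Ei mi; apply/eqP; apply: contraTT mi => fi.
have : [set` s] i by rewrite -sE.
by rewrite -leqNgt => /= si; rewrite leqW// leq_bigmax_seq.
Qed.

(** Quadratic homogeneity removes the normalization, and finite support turns the series into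
    truncated sums. Later bounds on [lambda0] go through this form. *)
Lemma le_lambda0P N a b c L : bd_killing_rates N a b c ->
  (L%:E <= lambda0 N a b c)%E <->
  forall m h, E N m -> L * mass a b m h <= energy a b c m h.
Proof.
move=> H; split=> [/ereal_infP LP m h Em|Lm]; last first.
  apply/ereal_infP => _ [f [fs f1] <-].
  have [m Em f0] := finsupp_bounded H fs.
  move: f1; rewrite (Dform_energy H Em f0) (L2norm_mass H Em f0).
  move=> [s1]; have M1 : mass a b m f = 1.
    by rewrite -(sqr_sqrtr (mass_ge0 f H Em)) s1 expr1n.
  by rewrite lee_fin (le_trans _ (Lm _ f Em))// M1 mulr1.
have M0 := mass_ge0 h H Em.
(* With zero mass no normalization is possible, but the claim is then nonnegativity of the
   energy. *)
have [M0'|Mp] := eqVneq (mass a b m h) 0.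
  by rewrite M0' mulr0 (energy_ge0 _ H).
have {}M0 : 0 < mass a b m h by rewrite lt_neqAle eq_sym Mp.
pose k := (Num.sqrt (mass a b m h))^-1.
have k2 : k ^+ 2 = (mass a b m h)^-1 by rewrite exprVn sqr_sqrtr// ltW.
pose f i := if (i <= m)%N then k * h i else 0.
have f0 i : E N i -> (m < i)%N -> f i = 0 by move=> _ mi; rewrite /f leqNgt mi.
have fm i : (i <= m)%N -> f i = k * h i by rewrite /f => ->.
have mf : mass a b m f = 1.
  rewrite -(mulVf Mp) -k2 /mass big_distrr/=; apply: eq_big_nat => i /andP[_ im].
  by rewrite fm//; ring.
have ef : energy a b c m f = k ^+ 2 * energy a b c m h.
  rewrite /energy !mulrDr fm// !big_distrr/=; congr (_ + _ + _).
  - by apply: eq_big_nat => i /andP[_ im]; rewrite !fm//; [ring|exact: ltnW].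
  - by ring.
  - by apply: eq_big_nat => i /andP[_ im]; rewrite fm//; ring.
have := LP (Dform N a b c f); rewrite (Dform_energy H Em f0) lee_fin ef.
rewrite k2 mulrC ler_pdivlMr//; apply.
exists f; last by rewrite (Dform_energy H Em f0) ef k2 mulrC.
split; last by rewrite (L2norm_mass H Em f0) mf sqrtr1.
apply: (@sub_finite_set _ _ `I_m.+1); last exact: finite_II.
move=> i [Ei] /=; apply: contraNT; rewrite -leqNgt => mi.
by rewrite f0.
Qed.

Lemma energy_ctilde N a b c m h :
  energy a b c m h = energy a b (ctilde N c) m h + infc N c * mass a b m h.
Proof.
rewrite /energy -!addrA; congr (_ + (_ + _)).
rewrite /mass big_distrr -big_split/=; apply: eq_bigr => i _.
by rewrite /ctilde; ring.
Qed.

End Truncation.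

(** * Picone's inequality and summation by parts *)

Section Gradient.
Context {R : realType}.
Implicit Types (w g h s : nat -> R) (m : nat).

(* Picone's inequality: termwise it reads
   [(y - x)^2 >= (y^2 / q - x^2 / p) (q - p)] for [p, q > 0], summed by parts. *)
Lemma picone w g h s m : (1 <= m)%N ->
  (forall i, (1 <= i <= m)%N -> 0 < g i) ->
  (forall i, (1 <= i < m)%N -> 0 <= w i) ->
  (forall i, (1 <= i < m)%N ->
    w i * (g i.+1 - g i) = \sum_(1 <= j < i.+1) s j) ->
  h m ^+ 2 / g m * \sum_(1 <= j < m.+1) s j -
    \sum_(1 <= i < m.+1) h i ^+ 2 / g i * s i <=
  \sum_(1 <= i < m) w i * (h i.+1 - h i) ^+ 2.
Proof.
elim: m => [//|[_ _ _ _ _|m IH _ g0 w0 ws]]; first by rewrite !big_nat1 big_geq// subrr.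
have {}IH : h m.+1 ^+ 2 / g m.+1 * \sum_(1 <= j < m.+2) s j -
    \sum_(1 <= i < m.+2) h i ^+ 2 / g i * s i <=
  \sum_(1 <= i < m.+1) w i * (h i.+1 - h i) ^+ 2.
  by apply: IH => // i /andP[i1 im]; [apply: g0|apply: w0|apply: ws];
    rewrite i1 ltnW.
rewrite [in leRHS]big_nat_recr//= [in leLHS]big_nat_recr//=.
rewrite [X in _ - X]big_nat_recr//= -ws ?ltnSn//.
move: IH; rewrite -ws ?ltnSn//.
have p0 : 0 < g m.+1 by apply: g0 => /=.
have q0 : 0 < g m.+2 by apply: g0 => /=.
have := w0 m.+1 (ltnSn _).
move: (g m.+1) (g m.+2) (h m.+1) (h m.+2) (w m.+1) (s m.+2) p0 q0 => p q x y v z p0 q0 v0.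
set S1 := \sum_(_ <= _ < _) _; set S2 := \sum_(_ <= _ < _) _.
suff : (y ^+ 2 / q - x ^+ 2 / p) * (q - p) <= (y - x) ^+ 2.
  by move=> /(ler_wpM2l v0); lra.
rewrite -subr_ge0.
(* The gap in Picone's inequality is a square divided by [p * q]. *)
have -> : (y - x) ^+ 2 - (y ^+ 2 / q - x ^+ 2 / p) * (q - p) =
   (y * p - x * q) ^+ 2 / (p * q) by field; rewrite !gt_eqF.
by rewrite divr_ge0 ?sqr_ge0// mulr_ge0// ltW.
Qed.

(** The equality case [h = g] of Picone's inequality, a discrete Green formula. *)
Lemma sum_by_parts w g s m : (1 <= m)%N ->
  (forall i, (1 <= i < m)%N ->
    w i * (g i.+1 - g i) = \sum_(1 <= j < i.+1) s j) ->
  \sum_(1 <= i < m) w i * (g i.+1 - g i) ^+ 2 =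
  g m * \sum_(1 <= j < m.+1) s j - \sum_(1 <= i < m.+1) g i * s i.
Proof.
elim: m => [//|[_ _ _|m IH _ ws]]; first by rewrite !big_nat1 big_geq// subrr.
rewrite big_nat_recr//= IH//; last first.
  by move=> i /andP[i1 im]; apply: ws; rewrite i1 ltnW.
rewrite expr2 mulrA ws ?ltnSn//.
rewrite [\sum_(1 <= j < m.+3) s j]big_nat_recr//=.
rewrite [\sum_(1 <= j < m.+3) _]big_nat_recr//=.
by ring.
Qed.

End Gradient.

(** * Barta's inequality *)

Section BartaBound.
Context {R : realType}.
Implicit Types (N : option nat) (a b c t r f g h : nat -> R) (m : nat).
Implicit Types (z eta l L : R).

Lemma II1 a b r f : II a b r f 1 = 0.
Proof. by rewrite /II big_geq. Qed.

Lemma IIS a b r f m : (1 <= m)%N ->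
  II a b r f m.+1 = II a b r f m +
    (mu a b m * b m)^-1 * \sum_(1 <= j < m.+1) r j * mu a b j * f j.
Proof. by move=> m1; rewrite /II big_nat_recr. Qed.

Lemma II_shift a b t eta f i :
  II a b (fun j => t j - eta) f i = II a b t f i - eta * II a b (fun=> 1) f i.
Proof.
rewrite /II big_distrr -sumrB/=; apply: eq_bigr => k _.
rewrite [eta * _]mulrCA -mulrBr; congr (_ * _).
by rewrite big_distrr -sumrB/=; apply: eq_bigr => j _; ring.
Qed.

(** The comparison function [g] of Barta's inequality. *)
Definition barta a b t eta f i : R := f 1%N + II a b (fun j => t j - eta) f i.

(** For [i < N] this is [mu_i b_i (g_{i+1} - g_i)] with [g] = [barta]; the sum form also makes sense
    at [i = N], where its sign is the boundary condition. *)
Definition flux a b t eta f i : R :=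
  \sum_(1 <= j < i.+1) (t j - eta) * mu a b j * f j.

Lemma mub_gt0 N a b c i : bd_killing_rates N a b c -> (1 <= i)%N -> ltN N i ->
  0 < mu a b i * b i.
Proof.
move=> H i1 iN; apply: mulr_gt0; last by case: H => _ b0 _ _ _; exact: b0.
by apply: (mu_gt0 H); split => //; case: N iN {H} => //= n; exact: ltnW.
Qed.

Lemma E_last N a b c i : bd_killing_rates N a b c -> E N i -> ltN N i = false ->
  N = Some i /\ b i = 0.
Proof.
move=> [bN _ _ _ _] [_ iN] iN'; case: N bN iN iN' => //= n [_ bn] iN.
by rewrite ltn_neqAle iN andbT => /negbFE/eqP->.
Qed.

Lemma barta_flux N a b c t eta f i :
  bd_killing_rates N a b c -> (1 <= i)%N -> ltN N i ->
  mu a b i * b i * (barta a b t eta f i.+1 - barta a b t eta f i) =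
  flux a b t eta f i.
Proof.
move=> H i1 iN; rewrite /barta IIS// -/(flux a b t eta f i).
have w0 := lt0r_neq0 (mub_gt0 H i1 iN).
by rewrite addrA [X in X - _]addrC addrK mulVKf.
Qed.

(** Picone's inequality with [g] = [barta] leaves a boundary term at [m] and a comparison site by
    site. *)
Lemma barta_le_energy N a b c t eta f z m h : bd_killing_rates N a b c ->
  (forall i, E N i -> 0 < barta a b t eta f i) ->
  (forall n, N = Some n -> 0 <= flux a b t eta f n) ->
  (forall i, E N i -> z <= t i + (eta - t i) * f i / barta a b t eta f i) ->
  E N m -> z * mass a b m h <= energy a b t m h.
Proof.
move=> H g0 fN zP Em; have [m1 _] := Em.
set g := barta a b t eta f in g0 zP *.
have w0 i : (1 <= i < m)%N -> 0 <= mu a b i * b i.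
  by move=> /andP[i1 im]; exact/ltW/(mub_gt0 H i1)/(E_ltN Em).
have wg i : (1 <= i < m)%N -> mu a b i * b i * (g i.+1 - g i) = flux a b t eta f i.
  by move=> /andP[i1 im]; exact/(barta_flux _ _ _ H i1)/(E_ltN Em).
have P := picone h m1 (fun i im => g0 i (E_le im Em)) w0 wg.
rewrite -/(flux a b t eta f m) in P.
(* For [m < N] the bracket equals [mu_m b_m g_{m+1}]; for [m = N] it is the flux, as [b_N = 0]. *)
have B : 0 <= h m ^+ 2 / g m * (flux a b t eta f m + mu a b m * b m * g m).
  apply: mulr_ge0; first by rewrite divr_ge0 ?sqr_ge0// ltW ?g0.
  case mN: (ltN N m); last first.
    have [NS ->] := E_last H Em mN.
    by rewrite mulr0 mul0r addr0 fN.
  rewrite -(barta_flux _ _ _ H m1 mN) -/g -mulrDr subrK.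
  apply: mulr_ge0; first exact/ltW/(mub_gt0 H m1).
  by apply/ltW/g0; split => //; case: N mN {H g0 fN zP Em}.
(* The pointwise bound on [z], weighted by [mu_i h_i^2] and summed. *)
have S : z * mass a b m h <=
    \sum_(1 <= i < m.+1) mu a b i * t i * h i ^+ 2 -
    \sum_(1 <= i < m.+1) h i ^+ 2 / g i * ((t i - eta) * mu a b i * f i).
  rewrite -sumrB /mass big_distrr/= !big_nat; apply: ler_sum => i im.
  have Ei := E_le im Em.
  have := zP _ Ei => /(ler_wpM2r (sqr_ge0 (h i))) /(ler_wpM2l (ltW (mu_gt0 H Ei))) /=.
  set A := mu a b i * (z * _); set B' := mu a b i * (_ * _).
  have -> : z * (mu a b i * h i ^+ 2) = A by rewrite /A; ring.
  suff -> : mu a b i * t i * h i ^+ 2 -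
    h i ^+ 2 / g i * ((t i - eta) * mu a b i * f i) = B' by [].
  by rewrite /B'; ring.
have gm := lt0r_neq0 (g0 _ Em).
have E1 : h m ^+ 2 / g m * (mu a b m * b m * g m) = mu a b m * b m * h m ^+ 2.
  by field.
by move: P B S; rewrite /energy mulrDr E1; lra.
Qed.

End BartaBound.

(** * Meaning of [xi]; lower bound and monotonicity of [zeta] *)

Section Bounds.
Context {R : realType}.
Context (N : option nat) (a b c : nat -> R) (H : bd_killing_rates N a b c).
Local Notation t := (ctilde N c).

Implicit Types (f g h r : nat -> R) (m : nat) (z eta l L : R).

Lemma muf_sum_ge0 r f m : (forall i, E N i -> 0 <= r i) ->
  (forall i, E N i -> 0 < f i) -> E N m ->
  0 <= \sum_(1 <= j < m.+1) r j * mu a b j * f j.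
Proof.
move=> r0 f0 Em; rewrite big_nat; apply: sumr_ge0 => i im.
have Ei := E_le im Em; apply: mulr_ge0 (ltW (f0 _ Ei)).
exact: mulr_ge0 (r0 _ Ei) (ltW (mu_gt0 H Ei)).
Qed.

Lemma II_ge0 r f i : (forall i, E N i -> 0 <= r i) ->
  (forall i, E N i -> 0 < f i) -> E N i -> 0 <= II a b r f i.
Proof.
move=> r0 f0 Ei; rewrite /II big_nat; apply: sumr_ge0 => k /andP[k1 ki].
rewrite mulr_ge0 ?invr_ge0 ?muf_sum_ge0//.
  exact/ltW/(mub_gt0 H k1)/(E_ltN Ei).
by apply: E_le Ei; rewrite k1 ltnW.
Qed.

Lemma muf_sum_gt0 f m : (forall i, E N i -> 0 < f i) -> E N m ->
  0 < \sum_(1 <= j < m.+1) mu a b j * f j.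
Proof.
move=> f0 Em; have [m1 _] := Em; rewrite big_nat_recr//=.
apply: ltr_wpDl; last by rewrite mulr_gt0 ?f0 ?(mu_gt0 H).
rewrite big_nat; apply: sumr_ge0 => i /andP[i1 im].
have Ei : E N i by apply: E_le Em; rewrite i1 ltnW.
by rewrite mulr_ge0// ltW ?f0 ?(mu_gt0 H).
Qed.

Lemma II_gt0 f i : (forall i, E N i -> 0 < f i) -> E2 N i ->
  0 < II a b (fun=> 1) f i.
Proof.
case: i => [|[|i]] f0 [// _ iN]; have Ei2 : E N i.+2 by [].
have Ei : E N i.+1 by apply: E_le Ei2; rewrite leqnSn.
rewrite IIS// ltr_wpDl ?II_ge0//.
rewrite mulr_gt0 ?invr_gt0 ?(mub_gt0 H) ?(E_ltN Ei2)//.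
by under eq_bigr do rewrite mul1r; exact: muf_sum_gt0.
Qed.

(** By [II_shift], [barta] and [flux] are affine in [eta]; clearing the positive denominators in
    [xi] turns its quotients into the thresholds for these two conditions. *)
Lemma le_xiP f eta : (forall i, E N i -> 0 < f i) ->
  (eta%:E <= xi N a b c f)%E <->
  (forall i, E2 N i -> f i <= barta a b t eta f i) /\
  (forall n, N = Some n -> 0 <= flux a b t eta f n).
Proof.
move=> f0; rewrite /xi; set I := ereal_inf _.
have IP : (eta%:E <= I)%E <-> (forall i, E2 N i -> f i <= barta a b t eta f i).
  have le_i i : E2 N i -> (eta <= (f 1%N - f i + II a b t f i) /
      II a b (fun=> 1) f i) = (f i <= barta a b t eta f i).
    move=> Ei; rewrite ler_pdivlMr ?II_gt0// /barta II_shift -subr_ge0.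
    by rewrite -[RHS]subr_ge0; congr (0 <= _); ring.
  split=> [/ereal_infP IP i Ei|IP].
    by rewrite -le_i// -lee_fin; apply: IP; exists i.
  by apply/ereal_infP => _ [i Ei <-]; rewrite lee_fin le_i// IP.
have fluxE n : E N n -> (eta <= (\sum_(1 <= j < n.+1) t j * mu a b j * f j) /
    (\sum_(1 <= j < n.+1) mu a b j * f j)) = (0 <= flux a b t eta f n).
  move=> En; rewrite ler_pdivlMr ?muf_sum_gt0// -subr_ge0; congr (0 <= _).
  by rewrite big_distrr -sumrB/=; apply: eq_bigr => j _; ring.
move: I IP fluxE; case EN : N => [n|] I IP fluxE; last by split=> [/IP|[/IP]].
have En : E (Some n) n.
  by split => //=; case: H => + _ _ _ _; rewrite EN => -[].
rewrite le_min lee_fin fluxE//; split=> [/andP[/IP ? ?]|[/IP -> ->//]].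
by split=> // _ [<-].
Qed.

Lemma le_barta f eta i : classF N a b c f -> (eta%:E <= xi N a b c f)%E ->
  E N i -> f i <= barta a b t eta f i.
Proof.
move=> [f0 _] /(le_xiP _ f0)[fg _] Ei.
case: i Ei => [|[|i]] Ei; first by case: Ei.
  by rewrite /barta II1 addr0.
by apply: fg; split => //; case: Ei.
Qed.

Lemma barta_gt0 f eta i : classF N a b c f -> (eta%:E <= xi N a b c f)%E ->
  E N i -> 0 < barta a b t eta f i.
Proof.
by move=> fF le_xi Ei; apply: lt_le_trans (le_barta fF le_xi Ei); case: fF => + _; apply.
Qed.

Lemma le_zeta z f eta : z <= eta ->
  (forall i, E2 N i -> t i < eta ->
    z <= t i + (eta - t i) * f i / barta a b t eta f i) ->
  (z%:E <= zeta N a b c eta f)%E.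
Proof.
move=> ze zP; rewrite /zeta; case: ifP => [_|_]; last by rewrite lee_fin.
by apply/ereal_infP => _ [i [Ei ti] <-]; rewrite lee_fin zP.
Qed.

Lemma zeta_le_quotient f eta i : E2 N i -> t i < eta ->
  (zeta N a b c eta f <=
    (t i + (eta - t i) * f i / barta a b t eta f i)%:E)%E.
Proof.
move=> Ei ti; rewrite /zeta ifT; first by apply: ereal_inf_lbound; exists i.
by apply/asboolP; exists i.
Qed.

(** With [0 < f <= g], each quotient is a convex combination of [t i] and [eta], with
    [t i < eta]. *)
Lemma zeta_le f eta : classF N a b c f -> (eta%:E <= xi N a b c f)%E ->
  (zeta N a b c eta f <= eta%:E)%E.
Proof.
move=> fF le_xi.
have [[i [Ei ti]]|S0] := pselect ([set i | E2 N i /\ t i < eta] !=set0).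
  apply: le_trans (zeta_le_quotient _ Ei ti) _; rewrite lee_fin.
  have E1i : E N i by case: Ei => i2 ?; split => //; exact: ltnW.
  rewrite addrC -lerBrDr -mulrA; apply: ler_piMr; first by rewrite subr_ge0 ltW.
  by rewrite ler_pdivrMr ?barta_gt0// mul1r le_barta.
by rewrite /zeta ifF//; apply/asboolPn.
Qed.

Lemma zeta_ge0 f eta : classF N a b c f -> 0 <= eta ->
  (eta%:E <= xi N a b c f)%E -> (0 <= zeta N a b c eta f)%E.
Proof.
move=> fF eta0 le_xi; apply: le_zeta => // i [i2 iN] ti.
have Ei : E N i by split => //; exact: ltnW.
apply: addr_ge0 (ctilde_ge0 H Ei) _; apply: divr_ge0; last first.
  exact: ltW (barta_gt0 fF le_xi Ei).
by apply: mulr_ge0; [rewrite subr_ge0 ltW|case: fF => /(_ _ Ei)/ltW].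
Qed.

Lemma zeta_fin f eta : classF N a b c f -> 0 <= eta ->
  (eta%:E <= xi N a b c f)%E -> exists z, zeta N a b c eta f = z%:E.
Proof.
move=> fF eta0 le_xi; have := zeta_ge0 fF eta0 le_xi.
by have := zeta_le fF le_xi; case: zeta => // z _ _; exists z.
Qed.

(** Barta's inequality needs the bound by [zeta] at every site of [E], so the sites left out of the
    infimum are checked separately. *)
Lemma zeta_le_lambda0 f eta : classF N a b c f -> 0 <= eta ->
  (eta%:E <= xi N a b c f)%E ->
  ((infc N c)%:E + zeta N a b c eta f <= lambda0 N a b c)%E.
Proof.
move=> fF eta0 le_xi; have [z zE] := zeta_fin fF eta0 le_xi.
have ze : z <= eta by rewrite -lee_fin -zE; exact: zeta_le.
have [f0 _] := fF.
rewrite zE -EFinD; apply/(le_lambda0P _ H) => m h Em.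
rewrite (energy_ctilde N) mulrDl addrC lerD2r.
apply: (barta_le_energy h H (fun i => barta_gt0 fF le_xi) _ _ Em).
  by case/(le_xiP _ f0): le_xi.
move=> i Ei; have g0 := barta_gt0 fF le_xi Ei.
have fg : f i / barta a b t eta f i <= 1.
  by rewrite ler_pdivrMr// mul1r le_barta.
have [te|te] := leP eta (t i).
  (* Here [eta - t i <= 0] and [f / g <= 1], so the value is at least [eta]. *)
  apply: le_trans ze _; rewrite -lerBlDl -mulrA.
  by rewrite ler_niMr// subr_le0.
(* At site 1, [g = f], so the value is exactly [eta]. *)
case: i Ei g0 fg te => [[]//|[|i]] Ei g0 fg te.
  by rewrite /barta II1 addr0 mulfK ?lt0r_neq0 ?f0// addrC subrK.
by rewrite -lee_fin -zE; apply: zeta_le_quotient => //; split => //; case: Ei.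
Qed.

(** Raising [eta] increases [eta - t i] and decreases [g], so each quotient grows. *)
Lemma zeta_homo f eta1 eta2 : classF N a b c f -> 0 <= eta1 -> eta1 <= eta2 ->
  (eta2%:E <= xi N a b c f)%E ->
  (zeta N a b c eta1 f <= zeta N a b c eta2 f)%E.
Proof.
move=> fF eta0 e12 le_xi2.
have le_xi1 : (eta1%:E <= xi N a b c f)%E by apply: le_trans le_xi2; rewrite lee_fin.
have [z zE] := zeta_fin fF eta0 le_xi1; have [f0 _] := fF.
have ze : z <= eta1 by rewrite -lee_fin -zE; exact: zeta_le.
rewrite zE; apply: le_zeta; first exact: le_trans e12.
move=> i Ei te2; have E1i : E N i by case: Ei => i2 ?; split => //; exact: ltnW.
have g2 := barta_gt0 fF le_xi2 E1i.
(* Sites that enter the infimum only at [eta2] have quotient at least [t i >= eta1 >= z]. *)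
have [te|te] := leP eta1 (t i).
  apply: le_trans (le_trans ze te) _; rewrite lerDl; apply: divr_ge0 (ltW g2).
  by apply: mulr_ge0 (ltW (f0 _ E1i)); rewrite subr_ge0 ltW.
have := zeta_le_quotient f Ei te; rewrite zE lee_fin => /le_trans; apply.
have g1 := barta_gt0 fF le_xi1 E1i.
rewrite lerD2l -!mulrA; apply: ler_pM.
- by rewrite subr_ge0 ltW.
- exact: divr_ge0 (ltW (f0 _ E1i)) (ltW g1).
- by rewrite lerD2r.
rewrite ler_pM2l ?f0// lef_pV2 ?posrE ?barta_gt0//.
rewrite /barta !II_shift !lerD2l lerN2 ler_wpM2r//.
exact/ltW/II_gt0.
Qed.

End Bounds.

(** * Positive solutions below the bottom of the spectrum *)

Section Eigenfunction.
Context {R : realType}.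
Context (N : option nat) (a b c : nat -> R) (H : bd_killing_rates N a b c).
Local Notation t := (ctilde N c).

Implicit Types (g : nat -> R) (m : nat) (l L : R).

(* The pair (value, flux) of the solution at site [k + 1]. *)
Fixpoint shoot l k : R * R :=
  if k is k'.+1 then
    let: (x, p) := shoot l k' in
    let x' := x + (mu a b k * b k)^-1 * p in
    (x', p + (t k.+1 - l) * mu a b k.+1 * x')
  else (1, (t 1%N - l) * mu a b 1).

(** [barta] at [i + 1] depends only on the values at [1, ..., i], so the equation is solved by
    recursion. It holds beyond [N] too, both sides using the same convention for the inverse of
    zero. *)
Lemma barta_fixpoint l : exists2 g : nat -> R, g 1%N = 1 &
  forall i, (1 <= i)%N -> barta a b t l g i = g i.
Proof.
pose g i := (shoot l i.-1).1.
have fluxE k : (shoot l k).2 = flux a b t l g k.+1.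
  elim: k => [|k IH]; first by rewrite /flux big_nat1 mulr1.
  by rewrite /flux big_nat_recr//= -/(flux a b t l g k.+1) -IH /g/=; case: shoot.
exists g => // -[//|k _]; elim: k => [|k IH]; first by rewrite /barta II1 addr0.
move: IH; rewrite /barta (@IIS _ _ _ _ _ k.+1)// addrA => ->.
by rewrite -/(flux a b t l g k.+1) -fluxE /g/=; case: shoot.
Qed.

(* The left-hand side is [mu_m b_m g_{m+1}] if [m < N], and the outgoing flux
   if [m = N]. *)
Lemma eigen_boundary_gt0 l L g m :
  (forall m h, E N m -> L * mass a b m h <= energy a b t m h) -> l < L ->
  (forall i, (1 <= i)%N -> barta a b t l g i = g i) -> E N m ->
  (forall i, (1 <= i <= m)%N -> 0 < g i) ->
  0 < flux a b t l g m + mu a b m * b m * g m.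
Proof.
move=> Lm lL gE Em g0; have [m1 _] := Em.
have := Lm m g Em.
have wg i : (1 <= i < m)%N -> mu a b i * b i * (g i.+1 - g i) = flux a b t l g i.
  move=> /andP[i1 im]; rewrite -(gE _ i1) -(gE i.+1)//.
  exact/(barta_flux _ _ _ H i1)/(E_ltN Em).
have := sum_by_parts m1 wg; rewrite -/(flux a b t l g m) /energy => ->.
(* Hence energy minus [l] times mass is [g m] times the boundary quantity, and it is at least
   [(L - l)] times the mass. *)
have E1 : \sum_(1 <= i < m.+1) mu a b i * t i * g i ^+ 2 =
  \sum_(1 <= i < m.+1) g i * ((t i - l) * mu a b i * g i) + l * mass a b m g.
  rewrite /mass big_distrr -big_split/=; apply: eq_bigr => i _; ring.
rewrite E1 => LM.
have M0 : 0 < mass a b m g.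
  rewrite /mass big_nat_recr//=; apply: ltr_wpDl.
    rewrite big_nat; apply: sumr_ge0 => i /andP[i1 im].
    have Ei : E N i by apply: E_le Em; rewrite i1 ltnW.
    exact: mulr_ge0 (ltW (mu_gt0 H Ei)) (sqr_ge0 _).
  by rewrite mulr_gt0 ?(mu_gt0 H)// exprn_gt0// g0// m1 leqnn.
have gm : 0 < g m by rewrite g0// m1 leqnn.
rewrite -(pmulr_rgt0 _ gm); apply: lt_le_trans (_ : (L - l) * mass a b m g <= _).
  by rewrite mulr_gt0// subr_gt0.
by move: LM; lra.
Qed.

(** Strong induction: positivity up to [m < N] makes [mu_m b_m g_{m+1}] positive. *)
Lemma eigen_gt0 l L g :
  (forall m h, E N m -> L * mass a b m h <= energy a b t m h) -> l < L ->
  g 1%N = 1 ->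
  (forall i, (1 <= i)%N -> barta a b t l g i = g i) ->
  forall i, E N i -> 0 < g i.
Proof.
move=> Lm lL g1 gE; elim/ltn_ind => -[_ []//|[|k]] IH Ek; first by rewrite g1.
have Ek1 : E N k.+1 by apply: E_le Ek; rewrite leqnSn.
have kN := E_ltN Ek (ltnSn _).
have := eigen_boundary_gt0 Lm lL gE Ek1.
rewrite -(barta_flux _ _ _ H _ kN)// !gE// -mulrDr subrK.
rewrite pmulr_rgt0 ?(mub_gt0 H)//; apply => i /andP[i1 ik].
by apply: IH => //; apply: E_le Ek1; rewrite i1.
Qed.

Lemma eigen_zeta l L : 0 < l -> l < L ->
  (forall m h, E N m -> L * mass a b m h <= energy a b t m h) ->
  exists2 f, classF N a b c f &
    (l%:E <= zeta N a b c (fine (xi N a b c f)) f)%E.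
Proof.
move=> l0 lL Lm; have [g g1 gE] := barta_fixpoint l.
have g0 := eigen_gt0 Lm lL g1 gE.
(* The strict inequality is the loss of [l * II(g) > 0]. *)
have gF : classF N a b c g.
  split=> // i Ei; rewrite -[ltLHS]gE; last by case: Ei => /ltnW.
  by rewrite /barta II_shift addrA ltrBlDr ltrDl mulr_gt0// (II_gt0 H).
have le_xi : (l%:E <= xi N a b c g)%E.
  apply/(le_xiP H _ g0); split=> [i [i2 _]|n Nn]; first by rewrite gE// ltnW.
  have En : E N n.
    by rewrite Nn; split => //=; case: H => + _ _ _ _; rewrite Nn => -[].
  have := eigen_boundary_gt0 Lm lL gE En (fun i im => g0 i (E_le im En)).
  by case: H => + _ _ _ _; rewrite Nn => -[_ ->]; rewrite mulr0 mul0r addr0 => /ltW.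
exists g => //; have [_ xi_fin] := xi_fin_num H gF.
apply: (@le_trans _ _ (zeta N a b c l g)).
  (* Since [barta] returns [g] itself, every quotient at [l] equals [l]. *)
  apply: le_zeta => // i Ei ti; have E1i : E N i by case: Ei => i2 ?; split => //; exact: ltnW.
  by rewrite gE ?mulfK ?lt0r_neq0 ?g0// 1?addrC ?subrK//; case: E1i.
apply: zeta_homo => //; rewrite ?fineK//; first exact: ltW.
by rewrite -lee_fin fineK.
Qed.

(** Any drop below the first value works, as [II] is nonnegative. This keeps the supremum from being
    taken over an empty set. *)
Lemma classF_neq0 : classF N a b c !=set0.
Proof.
exists (fun i => if i == 1%N then 1 else 2^-1).
have f0 i : 0 < (if i == 1%N then 1 else 2^-1 : R) by case: ifP.
split=> [i _|i [i2 iN]] //=; rewrite gtn_eqF//; apply: ltr_wpDr; last first.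
  by rewrite invf_lt1// ltr1n.
by apply: (II_ge0 H) => [j Ej|j _|]; [exact: (ctilde_ge0 H)|exact: f0|split=> //; exact: ltnW].
Qed.

End Eigenfunction.

(** * Assembly of the bounds and the variational formula *)

Theorem theorem9p6 (R : realType) (N : option nat) (a b c : nat -> R)
    (rates : bd_killing_rates N a b c) :
  [/\ forall (f : nat -> R) (eta : R), classF N a b c f ->
        0 <= eta -> (eta%:E <= xi N a b c f)%E ->
        ((infc N c)%:E + zeta N a b c eta f <= lambda0 N a b c)%E /\
        (zeta N a b c eta f <= eta%:E)%E,
      forall (f : nat -> R) (eta1 eta2 : R), classF N a b c f ->
        0 <= eta1 -> eta1 <= eta2 -> (eta2%:E <= xi N a b c f)%E ->
        (zeta N a b c eta1 f <= zeta N a b c eta2 f)%E &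
      lambda0 N a b c =
        ((infc N c)%:E +
         ereal_sup [set zeta N a b c (fine (xi N a b c f)) f
                   | f in classF N a b c])%E].
Proof.
have xi0 f : classF N a b c f -> 0 <= fine (xi N a b c f) /\
    ((fine (xi N a b c f))%:E <= xi N a b c f)%E.
  by move=> /(xi_fin_num rates)[x0 xf]; rewrite fine_ge0// fineK.
split=> [f eta fF eta0 le_xi|f eta1 eta2|].
- by split; [exact: zeta_le_lambda0|exact: (zeta_le rates)].
- exact: zeta_homo.
set S := ereal_sup _.
have S0 : (0 <= S)%E.
  have [f fF] := classF_neq0 rates; have [x0 le_x] := xi0 _ fF.
  apply: (@le_trans _ _ (zeta N a b c (fine (xi N a b c f)) f)).
    exact: zeta_ge0.
  by apply: ereal_sup_ubound; exists f.
apply/eqP; rewrite eq_le; apply/andP; split; last first.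
  rewrite addeC -leeBrDr//; apply: ge_ereal_sup => _ [f fF <-].
  have [x0 le_x] := xi0 _ fF.
  by rewrite leeBrDr// addeC; exact: zeta_le_lambda0.
case SE : S S0 => [s| |] S0; [|by rewrite addey// leey|by []].
rewrite leNgt; apply/negP => lt_l; have s0 : 0 <= s by rewrite -lee_fin.
(* A real level strictly above the supremum [s]; [s + 1] serves when [lambda0] is infinite. *)
have [L sL LP] : exists2 L, s < L & ((infc N c + L)%:E <= lambda0 N a b c)%E.
  case: lambda0 lt_l => [r| |]//.
    rewrite -EFinD lte_fin => lt_r; exists (r - infc N c); first by lra.
    by rewrite addrC subrK.
  by move=> _; exists (s + 1); [rewrite ltrDl|rewrite leey].
have Lm m h : E N m -> L * mass a b m h <= energy a b (ctilde N c) m h.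
  move=> Em; have /(le_lambda0P _ rates)/(_ m h Em) := LP.
  by rewrite (energy_ctilde N) mulrDl addrC lerD2r.
(* The midpoint of [s] and [L] is positive because [s >= 0]; it yields a [zeta] value above the
   supremum. *)
have [||f fF] := @eigen_zeta _ N a b c rates ((s + L) / 2) L _ _ Lm; [lra|lra|].
apply/negP; rewrite -ltNge.
apply: (@le_lt_trans _ _ S); first by apply: ereal_sup_ubound; exists f.
by rewrite SE lte_fin; lra.
Qed.
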